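(* If $T$ is an (undirected) forest and $\overset{\leftrightarrow}{T}$ denotes its biorientation, then $\text{mader}_{\vec{\chi}}(\overset{\leftrightarrow}{T})=v(\overset{\leftrightarrow}{T})$.
   Context: Graphs and digraphs are finite with a nonempty vertex set. Digraphs are loopless and have no parallel arcs, but may contain anti-parallel pairs of arcs $(x,y),(y,x)$ (digons). $v(D)$ denotes the number of vertices of a digraph $D$. The biorientation $\overset{\leftrightarrow}{G}$ of an undirected graph $G$ is the digraph on $V(G)$ obtained by replacing each edge $\{x,y\}$ of $G$ with both arcs $(x,y),(y,x)$. An acyclic $k$-coloring of $D$ is a map $c:V(D)\to\{1,\dots,k\}$ such that each color class $c^{-1}(i)$ induces an acyclic subdigraph (one with no directed cycle; a digon is a directed cycle of length 2). The dichromatic number $\vec{\chi}(D)$ is the smallest $k\in\mathbb{N}$ for which $D$ has an acyclic $k$-coloring. A subdivision of a digraph $F$ is any digraph obtained by replacing every arc $(x,y)$ of $F$ by a directed path from $x$ to $y$ (of length at least 1), where the subdivision paths of different arcs are internally vertex-disjoint (and their internal vertices are new vertices). A digraph $D$ contains a subdivision of $F$ if some subdigraph of $D$ is isomorphic to a subdivision of $F$. $\text{mader}_{\vec{\chi}}(F)$ denotes the smallest integer $k\ge 1$ such that every digraph $D$ with $\vec{\chi}(D)\ge k$ contains a subdivision of $F$ (it is known that such a $k$ exists for every digraph $F$). *)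

(* Defs.v *)
From mathcomp Require Import all_boot.
From mathcomp Require Import boolp classical_sets.

Set Implicit Arguments.
Unset Strict Implicit.
Unset Printing Implicit Defensive.

(* Arcs form a relation, so there are no parallel arcs; digons are allowed. *)
Record digraph := Digraph {
  dvertex :> finType;
  arc : rel dvertex;
  arc_irr : irreflexive arc;
  dvertex_gt0 : 0 < #|dvertex|
}.

Record graph := Graph {
  vertex :> finType;
  edge : rel vertex;
  edge_sym : symmetric edge;
  edge_irr : irreflexive edge;
  vertex_gt0 : 0 < #|vertex|
}.

(* [ucycle e s]: the entries of [s] are distinct and cyclically consecutive
   ones are related by [e].  An undirected cycle has length at least 3. *)
Definition is_forest (G : graph) : Prop :=
  forall s : seq G, 2 < size s -> ~ ucycle (@edge G) s.

Definition biorientation (G : graph) : digraph :=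
  Digraph (@edge_irr G) (vertex_gt0 G).

(* Directed cycles of the subdigraph induced by [A] are exactly those of [D]
   with all vertices in [A]. *)
Definition induces_acyclic (D : digraph) (A : pred D) : Prop :=
  forall s : seq D, 0 < size s -> all A s -> ~ ucycle (@arc D) s.

Definition acyclic_coloring (D : digraph) (k : nat) (c : D -> 'I_k) : Prop :=
  forall i : 'I_k, induces_acyclic [pred x | c x == i].

Definition acyclic_colorable (D : digraph) (k : nat) : Prop :=
  exists c : D -> 'I_k, acyclic_coloring c.

Lemma acyclic_colorable_card (D : digraph) : acyclic_colorable D #|D|.
Proof.
exists enum_rank => i [|x [|y s]] //= _.
  by move=> _ /andP[]; rewrite /= arc_irr.
move=> /and3P[/eqP xi /eqP yi _] /andP[_] /=.
by rewrite inE (enum_rank_inj (etrans xi (esym yi))) eqxx.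
Qed.

Lemma ex_acyclic_colorable (D : digraph) :
  exists k, `[< acyclic_colorable D k >].
Proof. by exists #|D|; apply/asboolP; exact: acyclic_colorable_card. Qed.

Definition dichromatic (D : digraph) : nat := ex_minn (ex_acyclic_colorable D).

(* The arcs traversed by the walk [x :: s]; [zip] drops the extra last item. *)
Definition walk_arcs (T : Type) (x : T) (s : seq T) : seq (T * T) :=
  zip (x :: s) s.

(* [b] maps the vertices of [F] to the branch vertices of [H], and [p x y]
   lists the internal vertices of the path that replaces the arc [(x, y)]; it
   is irrelevant when [(x, y)] is not an arc, and empty when the arc is not
   actually subdivided.  The last two clauses say that [H] has no vertices or
   arcs other than those of the construction. *)
Definition is_subdivision (F H : digraph) : Prop :=
  exists (b : F -> H) (p : F -> F -> seq H),
  [/\ injective b,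
      forall x y, arc x y ->
        [/\ path (@arc H) (b x) (rcons (p x y) (b y)),
            uniq (p x y)
          & forall z, b z \notin p x y],
      forall x y x' y', arc x y -> arc x' y' -> (x, y) <> (x', y') ->
        forall u, u \in p x y -> u \notin p x' y',
      forall u : H,
        (exists x, u = b x) \/ (exists x y, arc x y /\ u \in p x y)
    & forall u v : H, arc u v ->
        exists x y, arc x y /\
          (u, v) \in walk_arcs (b x) (rcons (p x y) (b y))].

(* An injective arc-preserving map is an isomorphism of [H] onto the subdigraph
   of [D] formed by the images of the vertices and arcs of [H]. *)
Definition isomorphic_to_subdigraph (H D : digraph) : Prop :=
  exists f : H -> D, injective f /\ forall u v, arc u v -> arc (f u) (f v).

Definition contains_subdivision (D F : digraph) : Prop :=
  exists H : digraph, is_subdivision F H /\ isomorphic_to_subdigraph H D.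

Definition mader_bound (F : digraph) (k : nat) : Prop :=
  0 < k /\ forall D : digraph, k <= dichromatic D -> contains_subdivision D F.

Definition is_smallest (P : nat -> Prop) (k : nat) : Prop :=
  P k /\ forall j, P j -> k <= j.

(* The default value 0 is returned only if no bound exists: it is not itself a
   [mader_bound]. *)
Definition mader (F : digraph) : nat :=
  xget 0 [set k | is_smallest (mader_bound F) k]%classic.

(* Main.v *)
(** If [A] is a maximal acyclic vertex set of [D], then [D - A] has dichromatic
    number at least that of [D] minus one, and every vertex [a] outside [A] lies
    on a directed cycle whose other vertices are all in [A].  Hence, once the
    forest minus a leaf has been embedded in [D - A], the leaf and the two paths
    joining it to its neighbour are found on the cycle through the vertex [a]
    representing that neighbour.
    Complete digraphs show that the bound is sharp. *)

From mathcomp Require Import all_boot.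
From mathcomp Require Import boolp.
From mathcomp Require classical_sets.
Require Import Defs.

Set Implicit Arguments.
Unset Strict Implicit.
Unset Printing Implicit Defensive.

(* Otherwise every path in [U] extends at its head: one of two neighbours of the
   head is off the path, since a path vertex other than the next one would close
   a cycle. *)
Lemma forest_leaf (G : graph) (U : {set G}) :
  is_forest G -> U != set0 ->
  exists2 x, x \in U &
    {in U &, forall y z, edge x y -> edge x z -> y = z}.
Proof.
move=> forestG /set0Pn[x0 Ux0]; apply: contrapT => no_leaf.
have long n : exists x s,
    [/\ size s = n, all [in U] (x :: s), uniq (x :: s) & path (@edge G) x s].
  elim: n => [|n [x [s [szs /andP[Ux Us] uxs xs]]]].
    by exists x0, [::]; rewrite /= Ux0.
  have [y [Uy xy ys]] : exists y, [/\ y \in U, edge x y & y \notin x :: s].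
    apply: contrapT => stuck; apply: no_leaf; exists x => // y z Uy Uz xy xz.
    have nbr t : t \in U -> edge x t -> t \in s.
      move=> Ut xt; have : t \in x :: s.
        by apply: contrapT => /negP ts; apply: stuck; exists t.
      by rewrite inE => /predU1P[tx|//]; rewrite tx edge_irr in xt.
    have is_head t : t \in U -> edge x t -> t = head x s.
      move=> Ut xt; apply: contrapT => ts.
      case/splitPr: (nbr _ Ut xt) uxs xs ts => s1 s2.
      case: s1 => [|a s1]; first by move=> _ _ [].
      rewrite -cat_rcons => + + _.
      rewrite -cat_cons cat_uniq => /andP[uxs _].
      rewrite /= cat_path rcons_path => /and3P[xa /andP[as1 s1t] _].
      apply: (forestG (x :: a :: rcons s1 t)); first by rewrite /= size_rcons.
      by rewrite /ucycle uxs /= !rcons_path last_rcons xa as1 s1t edge_sym xt.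
    by rewrite (is_head y) // (is_head z).
  exists y, (x :: s); split=> //=; first by rewrite szs.
  - by rewrite Uy Ux.
  - by rewrite ys.
  - by rewrite edge_sym xy.
(* The path [x :: s] would have [#|G|.+1] distinct vertices. *)
have [x [s [szs _ uxs _]]] := long #|G|.
by have := max_card [in x :: s]; rewrite (card_uniqP uxs) /= szs ltnn.
Qed.

(** * Embedding a forest by peeling off maximal acyclic sets *)

Section Embedding.
Variables (D : digraph) (T : graph).
Implicit Types (S A : {set D}) (U : {set T}).

(** Colors are natural numbers, bounded on [S] only, so that the empty set is 0-colorable although
    [D] has a vertex. *)
Definition colorable_on S (k : nat) : Prop :=
  exists c : D -> nat, {in S, forall x, c x < k} /\
    forall i, induces_acyclic [pred x | (x \in S) && (c x == i)].

Lemma colorable_onD S A k : induces_acyclic [in A] ->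
  colorable_on (S :\: A) k -> colorable_on S k.+1.
Proof.
move=> acA [c [ck acc]].
exists (fun x => if x \in A then k else c x); split=> [x Sx|i s s0 sP].
  by case: ifPn => // xA; rewrite ltnS ltnW ?ck // inE xA.
(* Outside [A] the colors stay below [k], so the class of [k] lies in [A] and every other class is
   contained in a class of [c]. *)
have [ik|ik] := eqVneq i k.
  apply: acA => //; apply: sub_all sP => x /= /andP[Sx].
  case: ifPn => // xA /eqP cx; have := ck x.
  by rewrite inE xA Sx cx ik ltnn => /(_ isT).
apply: (acc i) => //; apply: sub_all sP => x /= /andP[Sx].
by rewrite inE Sx andbT; case: ifP => //; rewrite eq_sym (negPf ik).
Qed.

(** By maximality [a |: A] carries a directed cycle, and it passes through [a] because [A] is
    acyclic. Rotated to start at [a], it has a next vertex [w] since there are no loops, and the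
    rest lies in [A] since [a] does not recur. *)
Lemma maximal_acyclic S : exists A,
  [/\ A \subset S, induces_acyclic [in A] &
      {in S :\: A, forall a : D, exists w s, [/\ w \in A, all [in A] s,
        uniq (w :: s) & path (@arc D) a (w :: rcons s a)]}].
Proof.
pose P A := (A \subset S) && `[< induces_acyclic [in A] >].
have P0 : P set0.
  by rewrite /P sub0set; apply/asboolP => -[|x s] //= _; rewrite inE.
have [A /maxsetP[/andP[AS /asboolP acA] maxA] _] := maxset_exists P0.
exists A; split=> // a /setDP[Sa aA].
have : ~ induces_acyclic [in a |: A].
  move=> ac; have := maxA (a |: A); rewrite /P subUset sub1set Sa AS subsetUr.
  by move=> /(_ (asboolT ac) isT) E; rewrite -E setU11 in aA.
move=> nac; apply: contrapT => none; apply: nac => s s0 sP sC.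
have as_ : a \in s.
  apply: contrapT => /negP as_; apply: (acA s) => //.
  apply/allP => x xs; have := allP sP x xs; rewrite /= in_setU1.
  by case/predU1P => [xa|//]; rewrite -xa xs in as_.
have [i s' Es] := rot_to as_.
move: sC; rewrite -(rot_ucycle i) Es => /andP[cs' us'].
have {}sP : all [in a |: A] (a :: s').
  by apply/allP => x; rewrite -Es mem_rot; exact: (allP sP).
case: s' {Es} cs' us' sP => [|w t] /=; first by rewrite arc_irr.
move=> cs' /and3P[awt wt ut] /and3P[_ wA tA].
have inA x : x \in a |: A -> x \in w :: t -> x \in A.
  by rewrite in_setU1 => /predU1P[->|//]; rewrite (negPf awt).
apply: none; exists w, t; split=> //=.
- by apply: inA wA _; rewrite mem_head.
- by apply/allP => x xt; apply: inA; [exact: (allP tA) | rewrite inE xt orbT].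
- by rewrite wt.
Qed.

(* The first three clauses of [is_subdivision], for the subgraph induced by [U],
   with all paths inside [S]. *)
Definition subdivided_in U S (b : T -> D) (p : T -> T -> seq D) : Prop :=
  [/\ {in U, forall x, b x \in S}, {in U &, injective b},
      {in U &, forall x y, edge x y ->
        [/\ path (@arc D) (b x) (rcons (p x y) (b y)), uniq (p x y),
            {subset p x y <= S} & {in U, forall z, b z \notin p x y}]}
    & {in U &, forall x y, {in U &, forall x' y', edge x y -> edge x' y' ->
        (x, y) <> (x', y') -> forall u, u \in p x y -> u \notin p x' y'}}].

Lemma forest_subdivided_in U S : is_forest T ->
  (forall k, k < #|U| -> ~ colorable_on S k) ->
  exists b p, subdivided_in U S b p.
Proof.
move=> forestT; move Em: #|U| => m; elim: m U S Em => [|m IH] U S cardU ncol.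
  move/eqP: cardU; rewrite cards_eq0 => /eqP ->.
  have [d _] := card_gt0P (dvertex_gt0 D).
  by exists (fun=> d), (fun _ _ => [::]); split=> x; rewrite inE.
have [l Ul leafl] : exists2 x, x \in U &
    {in U &, forall y z, edge x y -> edge x z -> y = z}.
  by apply: forest_leaf => //; rewrite -card_gt0 cardU.
have [A [AS acA cycA]] := maximal_acyclic S.
have [||b [p [bS b_inj pP pdisj]]] := IH (U :\ l) (S :\: A).
- by apply/eqP; rewrite -eqSS -cardU (cardsD1 l U) Ul.
- by move=> k km /(colorable_onD acA); apply: ncol.
(* [w] is the future image of the leaf [l]. Quantifying over [y] treats together a leaf with one
   neighbour in [U] and an isolated one. *)
have [w [s [wA sA uws ws]]] : exists w s, [/\ w \in A, all [in A] s,
    uniq (w :: s) & {in U :\ l, forall y, edge l y ->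
      path (@arc D) (b y) (w :: rcons s (b y))}].
  have [[v [Uv lv]]|iso] := pselect (exists v, v \in U :\ l /\ edge l v).
    have [w [s [wA sA uws ws]]] := cycA _ (bS v Uv).
    exists w, s; split=> // y /setD1P[_ Uy] ly.
    by case/setD1P: Uv => _ Uv; rewrite (leafl y v).
  (* For an isolated [l] any vertex of [A] serves. If [A] were empty, no vertex of [S] could lie on
     a cycle meeting [A], so [S] would be empty and 0-colorable. *)
  have [A0|[w wA]] := set_0Vmem A; last first.
    exists w, [::]; split=> // y Uy ly.
    by case: iso; exists y.
  have S0 x : x \in S -> False.
    by rewrite -(setD0 S) -A0 => /cycA[w [s []]]; rewrite A0 inE.
  case: (ncol 0) => //; exists (fun=> 0); split=> [x /S0 //|i [|x t] //= _].
  by case/andP=> /andP[/S0].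
have notA x : x \in S :\: A -> x \notin A by case/setDP.
have UD x : x \in U -> x != l -> x \in U :\ l by move=> Ux xl; rewrite !inE xl.
exists (fun x => if x == l then w else b x).
(* The cycle through [b y] is cut at [w]: the arc from [b y] to [w] stays unsubdivided, and the path
   back from [w] has internal vertices [s]. *)
exists (fun x y => if x == l then s else if y == l then [::] else p x y).
have [w_s us] : w \notin s /\ uniq s by apply/andP.
have bw x : x \in U -> x != l -> b x <> w.
  by move=> Ux xl E; have := notA _ (bS x (UD x Ux xl)); rewrite E wA.
split.
- move=> x Ux; case: eqVneq => [_|xl]; first exact: (subsetP AS).
  by case/setDP: (bS x (UD x Ux xl)).
- move=> x y Ux Uy.
  case: (eqVneq x l) => [->|xl]; case: (eqVneq y l) => [->|yl] //.
  + by move/esym/(bw y Uy yl).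
  + by move/(bw x Ux xl).
  + by apply: b_inj; apply: UD.
- move=> x y Ux Uy.
  case: (eqVneq x l) => [->|xl]; case: (eqVneq y l) => [->|yl] //.
  + by rewrite edge_irr.
  + move=> ly; have /= /andP[_ ->] := ws y (UD y Uy yl) ly.
    split=> // [z zs|z Uz].
      by apply: (subsetP AS); exact: (allP sA).
    case: eqVneq => [//|zl]; apply: contra (notA _ (bS z (UD z Uz zl))).
    exact: (allP sA).
  + rewrite edge_sym => lx; split=> //=.
    by have /= /andP[-> _] := ws x (UD x Ux xl) lx.
  + move=> xy; have [pa ua sa ba] := pP x y (UD x Ux xl) (UD y Uy yl) xy.
    split=> // [z zp|z Uz]; first by case/setDP: (sa z zp).
    case: eqVneq => [_|zl]; last exact: ba (UD z Uz zl).
    by apply: contraL wA => /sa /notA.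
- move=> x y Ux Uy x' y' Ux' Uy'.
  (* The earlier paths lie in [S :\: A], whereas [s] lies in [A]. *)
  have sp u z t : z \in U :\ l -> t \in U :\ l -> edge z t ->
      u \in p z t -> u \notin s.
    move=> Uz Ut zt; have [_ _ sa _] := pP z t Uz Ut zt.
    by move/sa/notA; apply: contra; exact: (allP sA).
  case: (eqVneq x l) => [->|xl]; case: (eqVneq x' l) => [->|xl'].
  + by move=> ly ly' []; rewrite (leafl y y').
  + case: (eqVneq y' l) => [//|yl'] _ xy' _ u; apply: contraL.
    by apply: sp xy'; apply: UD.
  + case: (eqVneq y l) => [//|yl] xy _ _ u.
    by apply: sp xy; apply: UD.
  + case: (eqVneq y l) => [//|yl]; case: (eqVneq y' l) => [//|yl'].
    by apply: pdisj; apply: UD.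
Qed.

End Embedding.

Lemma not_colorable_on (D : digraph) k :
  k < dichromatic D -> ~ colorable_on [set: D] k.
Proof.
rewrite /dichromatic; case: ex_minnP => m _ minm km [c [ck acc]].
have ckT x : c x < k by apply: ck; rewrite inE.
suff /asboolP/minm : acyclic_colorable D k by rewrite leqNgt km.
exists (fun x => Ordinal (ckT x)) => i s s0 sP; apply: (acc i) => //.
by apply: sub_all sP => x; rewrite /= inE -val_eqE.
Qed.

(** * From a system of paths to a subdivision *)

Lemma walk_arcs_path (V : eqType) (e : rel V) x s :
  path e x s = all (fun a => e a.1 a.2) (walk_arcs x s).
Proof. by elim: s x => //= y s IH x; rewrite IH. Qed.

Lemma walk_arcs_map (V W : Type) (f : V -> W) x s :
  walk_arcs (f x) (map f s) = [seq (f a.1, f a.2) | a <- walk_arcs x s].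
Proof. by elim: s x => //= y s IH x; rewrite -IH. Qed.

Section Subdivision.
Variables (D : digraph) (T : graph) (b : T -> D) (p : T -> T -> seq D).
Hypothesis bpP : subdivided_in [set: T] [set: D] b p.

(** An induced subdigraph of [D] could have arcs that [is_subdivision] forbids, so vertices and arcs
    are both restricted to those of the construction. *)
Let used := [pred u : D | [exists x, u == b x] ||
  [exists x, exists y, edge x y && (u \in p x y)]].
Let walk x y := walk_arcs (b x) (rcons (p x y) (b y)).
Let H_arc (u v : {u | used u}) :=
  [exists x, exists y, edge x y && ((val u, val v) \in walk x y)].

Let walk_arc x y u v : edge x y -> (u, v) \in walk x y -> arc u v.
Proof.
move=> xy; have [_ _ pP _] := bpP.
have [] := pP x y (in_setT _) (in_setT _) xy.
by rewrite walk_arcs_path => /allP pa _ _ _ /pa.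
Qed.

Let H_arcW u v : H_arc u v -> arc (val u) (val v).
Proof. by case/existsP => x /existsP[y /andP[xy]]; apply: walk_arc. Qed.

Let H_irr : irreflexive H_arc.
Proof. by move=> u; apply: contraTF isT => /H_arcW; rewrite arc_irr. Qed.

Let used_b x : used (b x).
Proof. by apply/orP; left; apply/existsP; exists x. Qed.

Let used_p x y : edge x y -> all used (p x y).
Proof.
move=> xy; apply/allP => u up; apply/orP; right.
by apply/existsP; exists x; apply/existsP; exists y; rewrite xy.
Qed.

Let H_gt0 : 0 < #|{: {u | used u}}|.
Proof.
have [x _] := card_gt0P (vertex_gt0 T).
by apply/card_gt0P; exists (exist _ (b x) (used_b x)).
Qed.

Lemma subdivided_contains : contains_subdivision D (biorientation T).
Proof.
have [_ b_inj pP pdisj] := bpP.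
pose H := Digraph H_irr H_gt0.
pose b' x : H := exist _ (b x) (used_b x).
(* When [(x, y)] is an edge, all entries of [p x y] are used and [insub] drops none of them. *)
pose p' x y : seq H := pmap insub (p x y).
have val_p x y : edge x y -> map val (p' x y) = p x y.
  move=> xy; rewrite pmap_filter; last exact: insubK.
  apply/all_filterP; apply: sub_all (used_p xy) => u.
  by rewrite /= isSome_insub.
have mem_p x y (u : H) : (u \in p' x y) = (val u \in p x y).
  by rewrite mem_pmap_sub.
have val_walk x y : edge x y -> walk x y =
    [seq (val a.1, val a.2) | a <- walk_arcs (b' x) (rcons (p' x y) (b' y))].
  by move=> xy; rewrite -walk_arcs_map map_rcons val_p.
exists H; split; last first.
  by exists val; split=> [|u v]; [exact: val_inj | exact: H_arcW].
exists b', p'; split.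
- by move=> x y [] /b_inj; apply; rewrite inE.
- move=> x y xy.
  have [_ up _ bp] := pP x y (in_setT _) (in_setT _) xy.
  split=> [||z].
  + rewrite walk_arcs_path; apply/allP => -[u v] uv.
    apply/existsP; exists x; apply/existsP; exists y; apply/andP.
    by split; rewrite // val_walk //; apply/mapP; exists (u, v).
  + by rewrite -(map_inj_uniq val_inj) val_p.
  + by rewrite mem_p; apply: bp; rewrite inE.
- move=> x y x' y' xy xy' ne u; rewrite !mem_p.
  by apply: pdisj; rewrite ?inE.
- move=> u; have /orP[/existsP[x /eqP ux]|] := valP u.
    by left; exists x; apply: val_inj.
  case/existsP => x /existsP[y /andP[xy up]].
  by right; exists x, y; rewrite mem_p.
- move=> u v /existsP[x /existsP[y /andP[xy uv]]]; exists x, y; split=> //.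
  move: uv; rewrite val_walk // => /mapP[[u' v'] uv' [/val_inj -> /val_inj ->]].
  exact: uv'.
Qed.

End Subdivision.

(** * Sharpness and conclusion *)

Lemma contains_subdivision_card (D F : digraph) :
  contains_subdivision D F -> #|F| <= #|D|.
Proof.
case=> H [[b [p [b_inj _ _ _ _]]] [f [f_inj _]]].
exact: leq_card (f \o b) (inj_comp f_inj b_inj).
Qed.

Lemma neq_irr (V : eqType) : irreflexive (fun x y : V => x != y).
Proof. by move=> x; rewrite eqxx. Qed.

(** Any two distinct vertices form a digon, so an acyclic coloring is injective. *)
Lemma dichromatic_complete (V : finType) (V0 : 0 < #|V|) :
  #|V| <= dichromatic (Digraph (@neq_irr V) V0).
Proof.
rewrite /dichromatic; case: ex_minnP => k /asboolP[c cP] _.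
rewrite -[k]card_ord; apply: (leq_card c) => x y cxy.
apply/eqP/negPn/negP => xy; apply: (cP (c x) [:: x; y]) => //=.
  by rewrite cxy eqxx.
by rewrite /ucycle /= inE xy eq_sym xy.
Qed.

Theorem corollary9 (T : graph) (hT : is_forest T) :
  mader (biorientation T) = #|biorientation T|.
Proof.
(* At most one number is a smallest bound, so [xget] returns the one exhibited. *)
suff nP : is_smallest (mader_bound (biorientation T)) #|T|.
  apply: classical_sets.xget_unique => // m [mP mmin].
  by apply/eqP; rewrite eqn_leq mmin ?nP.2 //; exact: nP.1.
split; first split; first exact: vertex_gt0.
  move=> D chiD.
  have [k|b [p bpP]] := @forest_subdivided_in D T [set: T] [set: D] hT.
    by rewrite cardsT => /leq_trans/(_ chiD)/not_colorable_on.
  exact: subdivided_contains bpP.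
(* The complete digraph on [j] vertices, nonempty as [0 < j], must contain a subdivision, hence has
   at least [#|T|] vertices. *)
move=> j [j0 jP]; have j0' : 0 < #|'I_j| by rewrite card_ord.
have := dichromatic_complete j0'; rewrite [X in X <= _]card_ord.
by move=> /jP/contains_subdivision_card; rewrite card_ord.
Qed.
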